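(* Let $k$ be a real constant with $k\neq 0$ and let $n\ge 1$ be an integer. Then there exists no $(2n+1)$-dimensional $\phi$-recurrent $N(k)$-contact metric manifold of constant curvature.
   Context: Manifolds are smooth and non-empty. A contact metric manifold is a $(2n+1)$-dimensional manifold $M$, $n\ge 1$, with a 1-form $\eta$ satisfying $\eta\wedge(d\eta)^n\neq 0$ everywhere, the characteristic vector field $\xi$ (determined by $\eta(\xi)=1$, $d\eta(\xi,\cdot)=0$), a Riemannian metric $g$ and a $(1,1)$-tensor field $\phi$ such that for all vector fields $X,Y$: $\eta(X)=g(X,\xi)$, $d\eta(X,Y)=g(X,\phi Y)$, $\phi^2X=-X+\eta(X)\xi$. Convention: $d\eta(X,Y)=\frac12\big(X\eta(Y)-Y\eta(X)-\eta([X,Y])\big)$. Let $\nabla$ be the Levi-Civita connection of $g$ and $R(X,Y)Z=\nabla_X\nabla_YZ-\nabla_Y\nabla_XZ-\nabla_{[X,Y]}Z$. The contact metric manifold is an $N(k)$-contact metric manifold, for a real constant $k$, if $R(X,Y)\xi=k[\eta(Y)X-\eta(X)Y]$ for all vector fields $X,Y$. It is $\phi$-recurrent if there exists a non-zero 1-form $A$ (i.e. not identically zero) such that $\phi^2((\nabla_WR)(X,Y)Z)=A(W)R(X,Y)Z$ for all vector fields $X,Y,Z,W$ (not necessarily orthogonal to $\xi$). Constant curvature means that there is a real constant $\lambda$ such that $R(X,Y)Z=\lambda(g(Y,Z)X-g(X,Z)Y)$ for all vector fields $X,Y,Z$. *)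

(* Defs.v *)
From HB Require Import structures.
From mathcomp Require Import all_boot all_order all_algebra all_fingroup.
From mathcomp Require Import all_classical all_reals all_analysis.
From mathcomp Require Import ring.
Set Implicit Arguments.
Unset Strict Implicit.
Unset Printing Implicit Defensive.
Import Order.TTheory GRing.Theory Num.Theory.
Import numFieldNormedType.Exports.
Local Open Scope classical_set_scope.
Local Open Scope ring_scope.

(* Meant for open [U]: all iterated directional derivatives up to order [k]
   exist and are continuous on [U]. *)
Fixpoint Ck_on (R : realType) (V W : normedModType R) (k : nat) (U : set V)
    (f : V -> W) : Prop :=
  match k with
  | 0%N => forall x, U x -> continuous_at x f
  | k'.+1 => [/\ forall x, U x -> continuous_at x f,
                 forall x v, U x -> derivable f x v
               & forall v, Ck_on k' U (fun x => 'D_v f x)]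
  end.

Definition smooth_on (R : realType) (V W : normedModType R) (U : set V)
  (f : V -> W) : Prop := forall k, Ck_on k U f.

Section SmoothOnTheory.
Variables (R : realType) (V : normedModType R) (U : set V).
Hypothesis oU : open U.

Lemma Ck_onS (W : normedModType R) k (f : V -> W) :
  Ck_on k.+1 U f -> Ck_on k U f.
Proof.
elim: k f => [|k IH] f; first by case.
by case=> cf df Df; split=> // v; apply: IH; exact: Df.
Qed.

Lemma eq_Ck_on (W : normedModType R) k (f g : V -> W) :
  (forall x, U x -> f x = g x) -> Ck_on k U f -> Ck_on k U g.
Proof.
elim: k f g => [|k IH] f g fg.
  move=> /= cf x Ux; rewrite /continuous_at -(fg x Ux).
  apply: cvg_trans (cf x Ux); apply: near_eq_cvg.
  by near=> y; apply: fg; near: y; exact: open_nbhs_nbhs.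
have nfg x : U x -> {near x, f =1 g}.
  by move=> Ux; near=> y; apply: fg; near: y; exact: open_nbhs_nbhs.
move=> [cf df Df]; split=> [x Ux|x v Ux|v].
- rewrite /continuous_at -(fg x Ux); apply: cvg_trans (cf x Ux).
  exact: near_eq_cvg (nfg x Ux).
- exact: near_eq_derivable (nfg x Ux) (df x v Ux).
- by apply: IH (Df v) => x Ux; apply: near_eq_derive; exact: nfg.
Unshelve. all: by end_near. Qed.

Lemma Ck_on_cst (W : normedModType R) k (a : W) : Ck_on k U (fun=> a).
Proof.
elim: k a => [|k IH] a; first by move=> x _; exact: cvg_cst.
split=> [x _|x v _|v]; [exact: cvg_cst|exact: derivable_cst|].
by apply: eq_Ck_on (IH 0) => x _; rewrite derive_cst.
Qed.

Lemma Ck_onD (W : normedModType R) k (f g : V -> W) :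
  Ck_on k U f -> Ck_on k U g -> Ck_on k U (f + g).
Proof.
elim: k f g => [|k IH] f g.
  by move=> cf cg x Ux; apply: cvgD; [exact: cf|exact: cg].
move=> [cf df Df] [cg dg Dg]; split=> [x Ux|x v Ux|v].
- by apply: cvgD; [exact: cf|exact: cg].
- by apply: derivableD; [exact: df|exact: dg].
- apply: eq_Ck_on (IH _ _ (Df v) (Dg v)) => x Ux.
  by rewrite deriveD; [|exact: df|exact: dg].
Qed.

Lemma Ck_onM k (f g : V -> R) :
  Ck_on k U f -> Ck_on k U g -> Ck_on k U (f * g).
Proof.
elim: k f g => [|k IH] f g.
  by move=> cf cg x Ux; apply: cvgM; [exact: cf|exact: cg].
move=> Cf Cg; have Cf' := Ck_onS Cf; have Cg' := Ck_onS Cg.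
move: Cf Cg => [cf df Df] [cg dg Dg]; split=> [x Ux|x v Ux|v].
- by apply: cvgM; [exact: cf|exact: cg].
- by apply: derivableM; [exact: df|exact: dg].
- apply: eq_Ck_on (Ck_onD (IH _ _ Cf' (Dg v)) (IH _ _ Cg' (Df v))) => x Ux.
  by rewrite deriveM; [|exact: df|exact: dg].
Qed.

End SmoothOnTheory.

Record chart (R : realType) (m : nat) (M : topologicalType) := Chart {
  chart_dom : set M;
  chart_map : M -> 'rV[R]_m;
  chart_inv : 'rV[R]_m -> M;
  open_chart_dom : open chart_dom;
  open_chart_img : open (chart_map @` chart_dom);
  chart_mapK : forall p, chart_dom p -> chart_inv (chart_map p) = p;
  chart_map_continuous : forall p, chart_dom p -> continuous_at p chart_map;
  chart_inv_continuous : forall x, (chart_map @` chart_dom) x ->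
    continuous_at x chart_inv }.

(* The smooth structure is the one generated by a (not necessarily maximal)
   atlas. *)
Record manifold (R : realType) (m : nat) := Manifold {
  carrier :> topologicalType;
  manifold_nonempty : [set: carrier] !=set0;
  manifold_hausdorff : hausdorff_space carrier;
  manifold_second_countable : @second_countable carrier;
  atlas : set (chart R m carrier);
  atlas_cover : forall p, exists2 c, atlas c & chart_dom c p;
  atlas_compatible : forall c c', atlas c -> atlas c' ->
    smooth_on (chart_map c @` (chart_dom c `&` chart_dom c'))
      (chart_map c' \o chart_inv c) }.

Section SmoothFunctions.
Variables (R : realType) (m : nat) (M : manifold R m).

Definition smooth (f : M -> R) : Prop := forall c, atlas c ->
  smooth_on (chart_map c @` chart_dom c) (f \o chart_inv c).

Definition smooth_pred : {pred (M -> R)} := fun f => `[< smooth f >].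

Lemma smooth_predP f : reflect (smooth f) (f \in smooth_pred).
Proof. exact: asboolP. Qed.

Lemma smooth_cst (a : R) : smooth (fun=> a).
Proof. by move=> c _ k; apply: Ck_on_cst; exact: open_chart_img. Qed.

Lemma smoothD f g : smooth f -> smooth g -> smooth (f + g).
Proof.
move=> sf sg c ac k.
exact: (Ck_onD (@open_chart_img _ _ _ c) (sf c ac k) (sg c ac k)).
Qed.

Lemma smoothM f g : smooth f -> smooth g -> smooth (f * g).
Proof.
move=> sf sg c ac k.
exact: (Ck_onM (@open_chart_img _ _ _ c) (sf c ac k) (sg c ac k)).
Qed.

Lemma smoothZ a f : smooth f -> smooth (a *: f).
Proof. exact: smoothM (smooth_cst a). Qed.

Lemma smoothN f : smooth f -> smooth (- f).
Proof. by rewrite -scaleN1r; exact: smoothZ. Qed.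

Fact smooth_subring : GRing.subring_closed smooth_pred.
Proof.
split=> [|f g|f g]; first exact/smooth_predP/smooth_cst.
- move=> /smooth_predP sf /smooth_predP sg.
  exact/smooth_predP/smoothD/smoothN.
- by move=> /smooth_predP sf /smooth_predP sg; exact/smooth_predP/smoothM.
Qed.

Fact smooth_scaler : GRing.scaler_closed smooth_pred.
Proof. by move=> a f /smooth_predP sf; exact/smooth_predP/smoothZ. Qed.

HB.instance Definition _ :=
  GRing.isSubringClosed.Build (M -> R) smooth_pred smooth_subring.
HB.instance Definition _ :=
  GRing.isScaleClosed.Build R (M -> R) smooth_pred smooth_scaler.

(* The commutative ring (and real vector space) of smooth functions *)
Record Cinf := MkCinf { Cinf_val :> M -> R; _ : Cinf_val \in smooth_pred }.
HB.instance Definition _ := [isSub for Cinf_val].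
HB.instance Definition _ := [Choice of Cinf by <:].
HB.instance Definition _ := GRing.SubChoice_isSubComPzRing.Build _ _ Cinf smooth_subring.
HB.instance Definition _ := [SubZmodule_isSubLmodule of Cinf by <:].

Lemma Cinf_smooth (f : Cinf) : smooth f.
Proof. by case: f => f /= /smooth_predP. Qed.

Definition to_Cinf (f : M -> R) (sf : smooth f) : Cinf :=
  MkCinf (introT (smooth_predP f) sf).

Lemma CinfP (f g : Cinf) : (forall p, f p = g p) -> f = g.
Proof. by move=> fg; apply/val_inj/funext. Qed.

Lemma CinfDE (f g : Cinf) p : (f + g) p = f p + g p. Proof. by []. Qed.
Lemma CinfNE (f : Cinf) p : (- f) p = - f p. Proof. by []. Qed.
Lemma CinfME (f g : Cinf) p : (f * g) p = f p * g p. Proof. by []. Qed.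
Lemma CinfZE a (f : Cinf) p : (a *: f) p = a * f p. Proof. by []. Qed.

End SmoothFunctions.

Section TangentVectors.
Variables (R : realType) (m : nat) (M : manifold R m).

(* Tangent vectors at [p] are the derivations at [p] of the smooth functions. *)
Definition derivation_at (p : M) (v : Cinf M -> R) : Prop :=
  (forall a f g, v (a *: f + g) = a * v f + v g) /\
  (forall f g, v (f * g) = v f * g p + f p * v g).

Definition derivation_pred (p : M) : {pred (Cinf M -> R)} :=
  fun v => `[< derivation_at p v >].

Lemma derivation_predP p v :
  reflect (derivation_at p v) (v \in derivation_pred p).
Proof. exact: asboolP. Qed.

Fact derivation_zmod p : GRing.zmod_closed (derivation_pred p).
Proof.
split=> [|u v].
  apply/derivation_predP; split=> [a f g|f g].
    by rewrite mulr0 addr0.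
  by rewrite mul0r mulr0 addr0.
move=> /derivation_predP[lu mu] /derivation_predP[lv mv].
apply/derivation_predP; split=> [a f g|f g]; rewrite /= !fctE /=.
  by rewrite lu lv; ring.
by rewrite mu mv; ring.
Qed.

Fact derivation_scaler p : GRing.scaler_closed (derivation_pred p).
Proof.
move=> b u /derivation_predP[lu mu].
apply/derivation_predP; split=> [a f g|f g]; rewrite /= !fctE /=.
  by rewrite lu /GRing.scale /=; ring.
by rewrite mu /GRing.scale /=; ring.
Qed.

HB.instance Definition _ p :=
  GRing.isZmodClosed.Build (Cinf M -> R) (derivation_pred p) (derivation_zmod p).
HB.instance Definition _ p :=
  GRing.isScaleClosed.Build R (Cinf M -> R) (derivation_pred p)
    (@derivation_scaler p).

Record tangent (p : M) := MkTangent {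
  tangent_val :> Cinf M -> R; _ : tangent_val \in derivation_pred p }.
HB.instance Definition _ p := [isSub for @tangent_val p].
HB.instance Definition _ p := [Choice of tangent p by <:].
HB.instance Definition _ p := [SubChoice_isSubZmodule of tangent p by <:].
HB.instance Definition _ p := [SubZmodule_isSubLmodule of tangent p by <:].

Lemma tangent_derivation p (v : tangent p) : derivation_at p v.
Proof. by case: v => v /= /derivation_predP. Qed.

Lemma tangentP p (u v : tangent p) : (forall f, u f = v f) -> u = v.
Proof. by move=> uv; apply/val_inj/funext. Qed.

Lemma tangentDE p (u v : tangent p) f : (u + v) f = u f + v f.
Proof. by []. Qed.
Lemma tangentNE p (v : tangent p) f : (- v) f = - v f. Proof. by []. Qed.
Lemma tangentZE p a (v : tangent p) f : (a *: v) f = a * v f. Proof. by []. Qed.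

End TangentVectors.

Section VectorFields.
Variables (R : realType) (m : nat) (M : manifold R m).

Record vfield := VField {
  vfield_val :> forall p : M, tangent p;
  vfield_smooth : forall f : Cinf M, smooth (fun p => vfield_val p f) }.

Lemma vfieldP (X Y : vfield) : (forall p, X p = Y p) -> X = Y.
Proof.
case: X Y => [X sX] [Y sY] /= XY.
have {}XY : X = Y by apply: functional_extensionality_dep.
by subst Y; congr VField; exact: Prop_irrelevance.
Qed.

(* The function [X f] *)
Definition vact (X : vfield) (f : Cinf M) : Cinf M :=
  to_Cinf (vfield_smooth X f).

HB.instance Definition _ := gen_eqMixin vfield.
HB.instance Definition _ := gen_choiceMixin vfield.

Definition vfield0 : vfield := @VField (fun=> 0) (fun=> @smooth_cst _ _ M 0).
Definition vfieldN (X : vfield) : vfield :=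
  @VField (fun p => - X p) (fun f => smoothN (vfield_smooth X f)).
Definition vfieldD (X Y : vfield) : vfield :=
  @VField (fun p => X p + Y p)
    (fun f => smoothD (vfield_smooth X f) (vfield_smooth Y f)).
Definition vfieldZ (h : Cinf M) (X : vfield) : vfield :=
  @VField (fun p => h p *: X p)
    (fun f => smoothM (Cinf_smooth h) (vfield_smooth X f)).

Fact vfieldDA : associative vfieldD.
Proof. by move=> X Y Z; apply: vfieldP => p /=; rewrite addrA. Qed.
Fact vfieldDC : commutative vfieldD.
Proof. by move=> X Y; apply: vfieldP => p /=; rewrite addrC. Qed.
Fact vfieldD0 : left_id vfield0 vfieldD.
Proof. by move=> X; apply: vfieldP => p /=; rewrite add0r. Qed.
Fact vfieldDN : left_inverse vfield0 vfieldN vfieldD.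
Proof. by move=> X; apply: vfieldP => p /=; rewrite addNr. Qed.

HB.instance Definition _ :=
  GRing.isZmodule.Build vfield vfieldDA vfieldDC vfieldD0 vfieldDN.

Fact vfieldZA h l X : vfieldZ h (vfieldZ l X) = vfieldZ (h * l) X.
Proof. by apply: vfieldP => p /=; rewrite scalerA. Qed.
Fact vfieldZ1 : left_id 1 vfieldZ.
Proof. by move=> X; apply: vfieldP => p /=; rewrite scale1r. Qed.
Fact vfieldZDr : right_distributive vfieldZ +%R.
Proof. by move=> h X Y; apply: vfieldP => p /=; rewrite scalerDr. Qed.
Fact vfieldZDl X : {morph vfieldZ^~ X : h l / h + l}.
Proof. by move=> h l; apply: vfieldP => p /=; rewrite scalerDl. Qed.

HB.instance Definition _ := GRing.Zmodule_isLmodule.Build (Cinf M) vfield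
  vfieldZA vfieldZ1 vfieldZDr vfieldZDl.

Lemma vfieldDE (X Y : vfield) p : (X + Y) p = X p + Y p. Proof. by []. Qed.
Lemma vfieldNE (X : vfield) p : (- X) p = - X p. Proof. by []. Qed.
Lemma vfieldZE (h : Cinf M) (X : vfield) p : (h *: X) p = h p *: X p.
Proof. by []. Qed.

Fact lie_derivation (X Y : vfield) (p : M) :
  derivation_at p (fun f => X p (vact Y f) - Y p (vact X f)).
Proof.
have actL Z a f g : vact Z (a *: f + g) = a *: vact Z f + vact Z g.
  by apply: CinfP => q /=; case: (tangent_derivation (Z q)) => -> _.
have actM Z f g : vact Z (f * g) = vact Z f * g + f * vact Z g.
  by apply: CinfP => q /=; case: (tangent_derivation (Z q)) => _ ->.
have [LX MX] := tangent_derivation (X p).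
have [LY MY] := tangent_derivation (Y p).
have DX f g : X p (f + g) = X p f + X p g.
  by have := LX 1 f g; rewrite scale1r mul1r.
have DY f g : Y p (f + g) = Y p f + Y p g.
  by have := LY 1 f g; rewrite scale1r mul1r.
split=> [a f g|f g].
  by rewrite !actL LX LY; ring.
by rewrite !actM DX DY !MX !MY /=; ring.
Qed.

Definition lie_at (X Y : vfield) (p : M) : tangent p :=
  MkTangent (introT (derivation_predP _ _) (lie_derivation X Y p)).

Fact lie_smooth X Y f : smooth (fun p => lie_at X Y p f).
Proof.
exact: smoothD (vfield_smooth X (vact Y f))
               (smoothN (vfield_smooth Y (vact X f))).
Qed.

Definition lie (X Y : vfield) : vfield := VField (lie_smooth X Y).

End VectorFields.

Section Tensors.
Variables (R : realType) (m : nat) (M : manifold R m).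

Record one_form := OneForm {
  one_form_val :> forall p : M, {linear tangent p -> R};
  one_form_smooth : forall X : vfield M, smooth (fun p => one_form_val p (X p)) }.

Definition one_form_app (w : one_form) (X : vfield M) : Cinf M :=
  to_Cinf (one_form_smooth w X).

(* A (1,1)-tensor field *)
Record endo_field := EndoField {
  endo_val :> forall p : M, {linear tangent p -> tangent p};
  endo_smooth : forall (X : vfield M) f, smooth (fun p => endo_val p (X p) f) }.

Definition endo_app (J : endo_field) (X : vfield M) : vfield M :=
  VField (endo_smooth J X).

Record rmetric := RMetric {
  rmetric_val :> forall p : M, tangent p -> tangent p -> R;
  rmetric_linear : forall (p : M) (a : R) (u v w : tangent p),
    rmetric_val (a *: u + v) w = a * rmetric_val u w + rmetric_val v w;
  rmetric_sym : forall (p : M) (u v : tangent p),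
    rmetric_val u v = rmetric_val v u;
  rmetric_pos : forall (p : M) (u : tangent p), u != 0 -> 0 < rmetric_val u u;
  rmetric_smooth : forall X Y : vfield M,
    smooth (fun p => rmetric_val (X p) (Y p)) }.

Definition rmetric_app (g : rmetric) (X Y : vfield M) : Cinf M :=
  to_Cinf (rmetric_smooth g X Y).

End Tensors.

Section Forms.
Variables (R : realType) (m : nat) (M : manifold R m).

(* Differential forms of degree [k], seen as functions of [k] vector fields *)
Definition kform (k : nat) := ('I_k -> vfield M) -> Cinf M.

(* The normalization [1 / (k + l)!] is the one that goes with the factor 1/2
   in [ext_d]. *)
Definition wedge (k l : nat) (a : kform k) (b : kform l) : kform (k + l) :=
  fun X => ((k + l)`!%:R : R)^-1 *:
    \sum_(s : 'S_(k + l)) ((-1) ^+ s : R) *: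
      (a (fun i => X (s (lshift l i))) * b (fun j => X (s (rshift k j)))).

Fixpoint wedge_pow2 (b : kform 2) (n : nat) : kform n.*2 :=
  match n with
  | 0%N => fun=> 1
  | n'.+1 => wedge b (@wedge_pow2 b n')
  end.

Definition form1 (w : one_form M) : kform 1 :=
  fun X => one_form_app w (X ord0).

Definition ext_d (w : one_form M) (X Y : vfield M) : Cinf M :=
  (2^-1 : R) *: (vact X (one_form_app w Y) - vact Y (one_form_app w X)
                 - one_form_app w (lie X Y)).

Definition ext_d2 (w : one_form M) : kform 2 :=
  fun X => ext_d w (X ord0) (X ord_max).

(* [w /\ (dw)^n] vanishes at no point; every tangent vector extends to a
   vector field, so it is enough to test it on vector fields. *)
Definition contact_form (w : one_form M) (n : nat) : Prop :=
  forall p, exists X, wedge (form1 w) (@wedge_pow2 (ext_d2 w) n) X p != 0.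

End Forms.

Section Curvature.
Variables (R : realType) (m : nat) (M : manifold R m).
Local Notation VF := (vfield M).

(* The Levi-Civita connection of [g], characterized as the torsion-free metric
   affine connection *)
Record levi_civita (g : rmetric M) (D : VF -> VF -> VF) : Prop := LeviCivita {
  connection_linear_l : forall (f : Cinf M) X Y Z,
    D (f *: X + Y) Z = f *: D X Z + D Y Z;
  connectionDr : forall X Y Z, D X (Y + Z) = D X Y + D X Z;
  connection_leibniz : forall X (f : Cinf M) Y,
    D X (f *: Y) = vact X f *: Y + f *: D X Y;
  connection_torsion_free : forall X Y, D X Y - D Y X = lie X Y;
  connection_metric : forall X Y Z,
    vact X (rmetric_app g Y Z) = rmetric_app g (D X Y) Z + rmetric_app g Y (D X Z) }.

Definition curvature (D : VF -> VF -> VF) (X Y Z : VF) : VF :=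
  D X (D Y Z) - D Y (D X Z) - D (lie X Y) Z.

(* [(D_W Rm)(X, Y) Z], where [Rm] is the curvature tensor of [D] *)
Definition cov_curvature (D : VF -> VF -> VF) (W X Y Z : VF) : VF :=
  let Rm := curvature D in
  D W (Rm X Y Z) - Rm (D W X) Y Z - Rm X (D W Y) Z - Rm X Y (D W Z).

Definition constant_curvature (g : rmetric M) (D : VF -> VF -> VF) : Prop :=
  exists lambda : R, forall X Y Z, curvature D X Y Z =
    (lambda *: rmetric_app g Y Z) *: X - (lambda *: rmetric_app g X Z) *: Y.

End Curvature.

Record contact_metric (R : realType) (n : nat) (M : manifold R n.*2.+1) :=
  ContactMetric {
  cm_phi : endo_field M;
  cm_xi : vfield M;
  cm_eta : one_form M;
  cm_g : rmetric M;
  cm_contact : contact_form cm_eta n;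
  cm_eta_xi : one_form_app cm_eta cm_xi = 1;
  cm_deta_xi : forall X, ext_d cm_eta cm_xi X = 0;
  cm_eta_g : forall X, one_form_app cm_eta X = rmetric_app cm_g X cm_xi;
  cm_deta_g : forall X Y,
    ext_d cm_eta X Y = rmetric_app cm_g X (endo_app cm_phi Y);
  cm_phi2 : forall X, endo_app cm_phi (endo_app cm_phi X) =
    - X + one_form_app cm_eta X *: cm_xi }.

Section ContactMetric.
Variables (R : realType) (n : nat) (M : manifold R n.*2.+1).
Variable C : contact_metric M.
Local Notation VF := (vfield M).

Definition Nk_contact_metric (k : R) (D : VF -> VF -> VF) : Prop :=
  forall X Y, curvature D X Y (cm_xi C) =
    (k *: one_form_app (cm_eta C) Y) *: X
    - (k *: one_form_app (cm_eta C) X) *: Y.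

Definition phi_recurrent (D : VF -> VF -> VF) : Prop :=
  exists2 A : one_form M, (exists W, one_form_app A W != 0) &
    forall X Y Z W,
      endo_app (cm_phi C) (endo_app (cm_phi C) (cov_curvature D W X Y Z)) =
      one_form_app A W *: curvature D X Y Z.

End ContactMetric.

(* Main.v *)
Require Import Defs.
From HB Require Import structures.
From mathcomp Require Import all_boot all_order all_algebra.
From mathcomp Require Import all_classical all_reals all_analysis.
From mathcomp Require Import ring.
Set Implicit Arguments.
Unset Strict Implicit.
Unset Printing Implicit Defensive.
Import Order.TTheory GRing.Theory Num.Theory.
Import numFieldNormedType.Exports.
Local Open Scope classical_set_scope.
Local Open Scope ring_scope.

(* Constant curvature expresses R through g, which is parallel, so the
   covariant derivative of R vanishes and phi-recurrence gives A(W) R = 0.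
   Where A(W) does not vanish, R(X,xi)xi = 0 and k != 0 force every vector
   field to be proportional to xi; since xi lies in the kernel of d eta, d eta
   vanishes at that point, against eta /\ (d eta)^n != 0. *)

Lemma vactZ (R : realType) (m : nat) (M : manifold R m) (X : vfield M) a f :
  vact X (a *: f) = a *: vact X f.
Proof.
apply: CinfP => p /=; have [L _] := tangent_derivation (X p).
have L0 : X p 0 = 0 by have := L (-1) 0 0; rewrite scaler0 addr0 mulN1r addNr.
by have := L a f 0; rewrite L0 !addr0.
Qed.

(** Metric compatibility turns the derivative of each coefficient such as [g(Y, Z)] into
    [g(D W Y, Z) + g(Y, D W Z)]; these terms, and those in [D W X] and [D W Y] from the Leibniz
    rule, cancel against the three corrections. *)
Lemma cov_curvature_constant (R : realType) (m : nat) (M : manifold R m)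
    (g : rmetric M) (D : vfield M -> vfield M -> vfield M) W X Y Z :
  levi_civita g D -> constant_curvature g D -> cov_curvature D W X Y Z = 0.
Proof.
move=> [_ DD DL _ Dg] [lambda Rm]; rewrite /cov_curvature !Rm -scaleNr.
rewrite DD !DL.
apply: vfieldP => p; apply: tangentP => f.
rewrite -[- (lambda *: _)]scaleNr !vactZ !Dg !vfieldDE !vfieldNE !vfieldDE !vfieldNE !vfieldZE.
rewrite !tangentDE !tangentNE !tangentDE !tangentNE !tangentZE.
rewrite !CinfZE !CinfDE /=.
transitivity (0 : R); [ring|by []].
Qed.

Lemma rmetricZl (R : realType) (m : nat) (M : manifold R m) (g : rmetric M)
    (p : M) a (u v : tangent p) : g p (a *: u) v = a * g p u v.
Proof.
have L b w z : g p (b *: w + z) v = b * g p w v + g p z v.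
  exact: rmetric_linear.
have g0 : g p 0 v = 0 by have := L (-1) 0 0; rewrite scaler0 addr0 mulN1r addNr.
by have := L a u 0; rewrite g0 !addr0.
Qed.

Lemma Cinf_sumE (R : realType) (m : nat) (M : manifold R m) (I : finType)
    (F : I -> Cinf M) (p : M) : (\sum_i F i) p = \sum_i F i p.
Proof. by elim/big_rec2: _ => // i x f _ <-. Qed.

(** Each summand over the permutations carries a value of [a] and a value of [b] at [p]. *)
Lemma wedge_eq0 (R : realType) (m : nat) (M : manifold R m) (k l : nat)
    (a : kform M k) (b : kform M l) (p : M) X :
  (forall Y, a Y p = 0) \/ (forall Y, b Y p = 0) -> wedge a b X p = 0.
Proof.
move=> ab0; rewrite /wedge CinfZE Cinf_sumE big1 ?mulr0 // => s _.
by rewrite CinfZE CinfME; case: ab0 => ->; rewrite ?mul0r ?mulr0.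
Qed.

(** As [n] is positive, the power of [dw] has a factor [dw]; were [dw] zero at [p], the whole wedge
    would vanish there. *)
Lemma contact_form_ext_d_neq0 (R : realType) (m : nat) (M : manifold R m)
    (w : one_form M) (n : nat) (p : M) :
  (0 < n)%N -> contact_form w n -> exists X Y, ext_d w X Y p != 0.
Proof.
case: n => // n _ /(_ p)[X]; apply: contra_neqP => dw0.
apply: wedge_eq0; right=> Y; apply: wedge_eq0; left=> Z.
by apply: contra_notP dw0 => /eqP dw0; exists (Z ord0), (Z ord_max).
Qed.

Theorem theorem4p1 (R : realType) (k : R) (n : nat) (k_neq0 : k != 0)
    (n_ge1 : (1 <= n)%N) :
  ~ exists (M : manifold R n.*2.+1) (C : contact_metric M)
      (D : vfield M -> vfield M -> vfield M),
    [/\ levi_civita (cm_g C) D, Nk_contact_metric C k D, phi_recurrent C D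
      & constant_curvature (cm_g C) D].
Proof.
move=> [M [C [D [LC Nk [A [W AW_neq0] rec] cc]]]].
have [p AWp] : exists p, one_form_app A W p != 0.
  apply: contra_neqP AW_neq0 => A0; apply: CinfP => p.
  by apply: contra_notP A0 => /eqP AWp; exists p.
have Xxi (X : vfield M) : X p = one_form_app (cm_eta C) X p *: cm_xi C p.
  (* With [Y = Z = xi] the recurrence reads [0 = A(W) k (X - eta(X) xi)] at [p], where both scalars
     can be cancelled. *)
  have /(congr1 (fun V : vfield M => V p)) := rec X (cm_xi C) (cm_xi C) W.
  rewrite (cov_curvature_constant _ _ _ _ LC cc) Nk cm_eta_xi /= !linear0.
  move/esym/eqP; rewrite scaler_eq0 (negPf AWp) => /eqP/subr0_eq.
  rewrite -[LHS]/((k * 1) *: X p) -[RHS]/((k * one_form_app (cm_eta C) X p) *: cm_xi C p).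
  by rewrite mulr1 -scalerA; exact: scalerI.
have [X [Y]] := contact_form_ext_d_neq0 p n_ge1 (cm_contact C).
(* Here [g(xi, phi Y) = d eta(xi, Y) = 0], and at [p] the field [X] is a multiple of [xi], so
   [d eta(X, Y)] vanishes there too. *)
have /(congr1 (fun f : Cinf M => f p)) := cm_deta_xi C Y.
rewrite !cm_deta_g /= => gxi0.
by rewrite (Xxi X) rmetricZl gxi0 mulr0 eqxx.
Qed.
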